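(* Let $r\ge1$ be an integer. (1) As $N\to\infty$, $M_r^+(N)\sim N_r^+(N)$. (2) There exists $n_r\in\mathbb N$ such that $M_r^+(N)>N_r^+(N)$ for all $N\ge n_r$.
   Context: For a partition $\lambda$, $\mathrm{rank}(\lambda)$ is the largest part of $\lambda$ minus the number of parts of $\lambda$. Let $o(\lambda)$ be the number of ones in $\lambda$ and $\mu(\lambda)$ the number of parts strictly larger than $o(\lambda)$; $\mathrm{crank}(\lambda)$ is the largest part of $\lambda$ if $o(\lambda)=0$, and $\mu(\lambda)-o(\lambda)$ if $o(\lambda)>0$. $M(m,N)$ (resp. $N(m,N)$) is the number of partitions of $N$ with crank (resp. rank) $m$, with the convention (forced by the generating function of the crank) that for $N=1$ one sets $M(0,1)=-1$, $M(1,1)=M(-1,1)=1$ and $M(m,1)=0$ otherwise. The $r$-th positive crank and rank moments are $M_r^+(N):=\sum_{m\ge1}m^rM(m,N)$ and $N_r^+(N):=\sum_{m\ge1}m^rN(m,N)$. *)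

(* Defs.v *)
From HB Require Import structures.
From mathcomp Require Import all_boot all_order all_algebra.

Set Implicit Arguments.
Unset Strict Implicit.
Unset Printing Implicit Defensive.

Import Order.TTheory GRing.Theory Num.Theory.

(* An integer partition of N is the nonincreasing sequence of its parts. *)
Definition is_intpart (N : nat) (s : seq nat) : bool :=
  [&& sorted geq s, 0 \notin s & sumn s == N].

Definition largest_part (s : seq nat) : nat := \max_(i <- s) i.

Definition ones (s : seq nat) : nat := count_mem 1 s.

Definition mu (s : seq nat) : nat := count (fun i => ones s < i) s.

Definition part_rank (s : seq nat) : int :=
  ((largest_part s)%:Z - (size s)%:Z)%R.

Definition part_crank (s : seq nat) : int :=
  (if ones s == 0%N then (largest_part s)%:Z
   else (mu s)%:Z - (ones s)%:Z)%R.

(* A partition of N has at most N parts, each at most N, so that the finite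
   type N.-bseq 'I_N.+1 contains each of them exactly once (see
   intpart_in_bseq and intpart_bseq_inj). *)
Definition num_intpart (N : nat) (P : pred (seq nat)) : nat :=
  #|[set t : N.-bseq 'I_N.+1 |
      is_intpart N (map val t) && P (map val t)]|.

Definition rank_count (m : int) (N : nat) : int :=
  Posz (num_intpart N (fun s => part_rank s == m)).

(* At N = 1 the value is prescribed by the crank generating function. *)
Definition crank_count (m : int) (N : nat) : int :=
  if N == 1 then
    (if m == 0 then -1 else if (m == 1) || (m == -1) then 1 else 0)%R
  else Posz (num_intpart N (fun s => part_crank s == m)).

(* The sums over all m >= 1 are cut at m = N, as the summands vanish for
   m > N (see rank_count_gt and crank_count_gt). *)
Definition pos_rank_moment (r N : nat) : int :=
  (\sum_(1 <= m < N.+1) m%:Z ^+ r * rank_count m%:Z N)%R.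

Definition pos_crank_moment (r N : nat) : int :=
  (\sum_(1 <= m < N.+1) m%:Z ^+ r * crank_count m%:Z N)%R.

Lemma leq_sumn (s : seq nat) (i : nat) : i \in s -> i <= sumn s.
Proof.
elim: s => //= x s IH; rewrite inE => /orP[/eqP->|/IH le_i].
  exact: leq_addr.
exact: leq_trans le_i (leq_addl _ _).
Qed.

Lemma size_leq_sumn (s : seq nat) : 0 \notin s -> size s <= sumn s.
Proof.
elim: s => //= x s IH; rewrite inE negb_or eq_sym -lt0n => /andP[x_gt0 /IH].
by move=> le_s; rewrite -add1n leq_add.
Qed.

Lemma intpart_in_bseq (N : nat) (s : seq nat) :
  is_intpart N s -> exists t : N.-bseq 'I_N.+1, map val t = s.
Proof.
case/and3P=> _ s0 /eqP sumN.
have szs : size (map (@inord N) s) <= N.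
  by rewrite size_map -sumN; apply: size_leq_sumn.
exists (Bseq szs) => /=; rewrite -map_comp; apply: map_id_in => i si /=.
by rewrite inordK // ltnS -sumN; apply: leq_sumn.
Qed.

Lemma intpart_bseq_inj (N : nat) :
  injective (fun t : N.-bseq 'I_N.+1 => map val t).
Proof. by move=> t u /(inj_map val_inj) tu; apply: val_inj. Qed.

Lemma largest_part_leq (N : nat) (s : seq nat) :
  is_intpart N s -> largest_part s <= N.
Proof.
case/and3P=> _ _ /eqP <-; apply/bigmax_leqP_seq => i si _.
exact: leq_sumn.
Qed.

Lemma num_intpart_eq0 (N : nat) (P : pred (seq nat)) :
  (forall s, is_intpart N s -> ~~ P s) -> num_intpart N P = 0.
Proof.
move=> noP; apply/eqP; rewrite cards_eq0 -subset0; apply/subsetP=> t.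
by rewrite inE => /andP[/noP/negP].
Qed.

Lemma rank_count_gt (m N : nat) : N < m -> rank_count (Posz m) N = 0%R.
Proof.
move=> ltNm; rewrite /rank_count num_intpart_eq0 // => s ps.
rewrite lt_eqF // /part_rank; apply: (@le_lt_trans _ _ (Posz N)) => //.
by rewrite lerBlDr ler_wpDr // lez_nat largest_part_leq.
Qed.

Lemma crank_count_gt (m N : nat) : N < m -> crank_count (Posz m) N = 0%R.
Proof.
move=> ltNm; rewrite /crank_count; case: eqP => [N1|_].
  by move: ltNm; rewrite N1; case: m => [|[|m]].
rewrite num_intpart_eq0 // => s ps.
rewrite lt_eqF //; apply: (@le_lt_trans _ _ (Posz N)) => //.
rewrite /part_crank; case: eqP => _.
  by rewrite lez_nat largest_part_leq.
rewrite lerBlDr ler_wpDr // lez_nat.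
case/and3P: ps => _ s0 /eqP <-.
exact: leq_trans (count_size _ _) (size_leq_sumn s0).
Qed.

(* Main.v *)
(* Both inequalities come from exact counts.  Moving one bead of the Maya
   diagram of a partition shows that the number C(k, N) of partitions of N with
   a part s_i = i + k (i counted from 0) satisfies
     C(k, N) = p(N - k) - C(k + 1, N - k),
   and C(k, N) is also the number of partitions of N of crank at least k >= 1.
   Dyson's adjoint gives R(k, N) = p(N - k - 1) - R(k + 3, N - k - 1) for the
   number R(k, N) of partitions of N of rank at least k.  Iterating the two
   recurrences,
     E(m, N) := sum_(k >= m) (C(k, N) - R(k, N))
              = sum_(j >= 0) (-1)^j C(m + 2 j, N - j m - j (3 j - 1) / 2),
   an alternating sum of decreasing terms, so 0 <= E(m, N) <= C(m, N).  Summing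
   by parts twice, M_r^+ - N_r^+ is a combination of the E(m, N) with
   nonnegative coefficients and E(1, N) > 0 for N >= 5: this is (2).  The upper
   bound gives M_r^+ - N_r^+ <= sum_m (m^r - (m-1)^r) M(m, N), which is
   o(M_r^+) once p(N) = o(M_r^+).  Finally 2 M_r^+ >= sum_(m >= 1) p(N - m),
   which counts the pairs (partition of N, one of its part sizes), and
   partitions with a bounded number of part sizes are polynomially many while
   p(N) >= 2^r for r (r + 1) <= N. *)

Require Import Defs.
From mathcomp Require Import all_boot all_order all_algebra.
From mathcomp Require Import all_classical all_reals all_analysis.
From mathcomp Require Import zify ring.

Import Order.TTheory GRing.Theory Num.Theory.
Import numFieldNormedType.Exports.

Set Implicit Arguments.
Unset Strict Implicit.
Unset Printing Implicit Defensive.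

(** * Comparing counts of partitions by injections and bijections *)

(** The default [[bseq]] is only reached outside the partitions of [N], so injections can be given
    on plain sequences. *)
Definition bseq_enc (N : nat) (s : seq nat) : N.-bseq 'I_N.+1 :=
  odflt [bseq] [pick t : N.-bseq 'I_N.+1 | map val t == s].

Lemma bseq_encK (N : nat) (s : seq nat) :
  is_intpart N s -> map val (bseq_enc N s) = s.
Proof.
case/intpart_in_bseq => t ts; rewrite /bseq_enc.
by case: pickP => [u /eqP //|/(_ t)]; rewrite ts eqxx.
Qed.

Lemma leq_card_num_intpart (T : finType) (A : {set T}) (f : T -> seq nat)
    (N : nat) (P : pred (seq nat)) :
    {in A, forall x, is_intpart N (f x) && P (f x)} ->
    {in A &, injective f} ->
  #|A| <= num_intpart N P.
Proof.
move=> fP f_inj; rewrite -(@card_in_imset _ _ (fun x => bseq_enc N (f x))).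
  apply/subset_leq_card/fintype.subsetP => _ /imsetP[x xA ->].
  by case/andP: (fP x xA) => fN fPx; rewrite inE bseq_encK // fN.
move=> x y xA yA /(congr1 (fun t : N.-bseq 'I_N.+1 => map val t)).
case/andP: (fP x xA) => fx _; case/andP: (fP y yA) => fy _.
by rewrite !bseq_encK //; apply: f_inj.
Qed.

Lemma leq_num_intpart (N N' : nat) (P Q : pred (seq nat))
    (f g : seq nat -> seq nat) :
    (forall s, is_intpart N s -> P s ->
       [/\ is_intpart N' (f s), Q (f s) & g (f s) = s]) ->
  num_intpart N P <= num_intpart N' Q.
Proof.
move=> fP.
apply: (leq_card_num_intpart (f := fun t : N.-bseq 'I_N.+1 => f (map val t))).
  by move=> t; rewrite inE => /andP[/fP tP /tP [-> ->]].
move=> t u; rewrite !inE => /andP[/fP tP /tP [_ _ ft]].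
case/andP=> [/fP uP /uP [_ _ fu]] /(congr1 g); rewrite ft fu.
exact: intpart_bseq_inj.
Qed.

Lemma eq_num_intpart_bij (N N' : nat) (P Q : pred (seq nat))
    (f g : seq nat -> seq nat) :
    (forall s, is_intpart N s -> P s ->
       [/\ is_intpart N' (f s), Q (f s) & g (f s) = s]) ->
    (forall s, is_intpart N' s -> Q s ->
       [/\ is_intpart N (g s), P (g s) & f (g s) = s]) ->
  num_intpart N P = num_intpart N' Q.
Proof.
by move=> fP gP; apply/eqP;
  rewrite eqn_leq (leq_num_intpart fP) (leq_num_intpart gP).
Qed.

Lemma eq_num_intpart (N : nat) (P Q : pred (seq nat)) :
    (forall s, is_intpart N s -> P s = Q s) ->
  num_intpart N P = num_intpart N Q.
Proof.
by move=> PQ; apply: (@eq_num_intpart_bij _ _ _ _ id id) => s sN;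
  rewrite PQ.
Qed.

Lemma sub_num_intpart (N : nat) (P Q : pred (seq nat)) :
    (forall s, is_intpart N s -> P s -> Q s) ->
  num_intpart N P <= num_intpart N Q.
Proof. by move=> PQ; apply: (@leq_num_intpart _ _ _ _ id id) =>
  s sN /PQ ->. Qed.

Lemma num_intpartID (N : nat) (P Q : pred (seq nat)) :
  num_intpart N P =
  num_intpart N (fun s => P s && Q s) + num_intpart N (fun s => P s && ~~ Q s).
Proof.
rewrite /num_intpart -(cardsID [set t : N.-bseq 'I_N.+1 | Q (map val t)]).
by congr (_ + _); apply: eq_card => t; rewrite !inE; case: (is_intpart _ _);
  case: (P _); case: (Q _).
Qed.

Definition npart (N : nat) : nat := num_intpart N predT.

Lemma npartID (N : nat) (P : pred (seq nat)) :
  npart N = num_intpart N P + num_intpart N (predC P).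
Proof. exact: (num_intpartID N predT P). Qed.

Lemma num_intpart_le (N : nat) (P : pred (seq nat)) :
  num_intpart N P <= npart N.
Proof. exact: sub_num_intpart. Qed.

Lemma path_geqW (x : nat) (s : seq nat) :
  path geq x s -> forall y, x <= y -> path geq y s.
Proof. by case: s => //= z s /andP[zx ->] y /(leq_trans zx) ->. Qed.

(** * Beads *)

(* For a nonincreasing [s]: some index [i], counted from 0, has
   [nth 0 s i = i + m]. *)
Fixpoint bead (m : nat) (s : seq nat) : bool :=
  if s is x :: s' then if m < x then bead m.+1 s' else x == m else false.

(** Place beads at the positions [s_i - i], with [s] extended by zeros. If [m] is occupied, [pop m]
    removes that bead and moves all others up by one, which leaves [m + 1] vacant; [push m] reverses
    this. *)
Fixpoint pop (m : nat) (s : seq nat) : seq nat :=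
  if s is x :: s' then if m < x then x.+1 :: pop m.+1 s' else s' else [::].

Fixpoint push (m : nat) (s : seq nat) : seq nat :=
  if s is x :: s' then if m.+1 < x then x.-1 :: push m.+1 s' else m :: s
  else [:: m].

Lemma bead_lt (m x : nat) (s : seq nat) :
  path geq x s -> x < m -> bead m s = false.
Proof. by case: s => //= y s /andP[/= yx _] xm; case: ifP => [|_]; lia. Qed.

Lemma path_pop m x s : path geq x s -> path geq x.+1 (pop m s).
Proof.
elim: s m x => //= y s IH m x /andP[yx ys]; case: ifP => _ /=.
  by rewrite ltnS yx IH.
by apply: path_geqW ys _ _; lia.
Qed.

(** The vacancy is needed where [push] inserts its new part: the next part is at most one more than
    the inserted one, and equality would be a bead. *)
Lemma path_push m x s :
  path geq x s -> m < x -> ~~ bead m.+1 s -> path geq x.-1 (push m s).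
Proof.
elim: s m x => [|y s IH] m x /=; first by move=> _ mx _; rewrite andbT; lia.
case/andP=> yx ys mx; case: ifP => ym nb /=.
  by rewrite IH // andbT; lia.
rewrite ys andbT; apply/andP; split; lia.
Qed.

Lemma pop_neq0 m s : 0 \notin s -> 0 \notin pop m s.
Proof.
elim: s m => //= y s IH m; rewrite inE negb_or => /andP[y0 s0].
by case: ifP => // _; rewrite inE /= IH.
Qed.

Lemma push_neq0 m s : 0 < m -> 0 \notin s -> 0 \notin push m s.
Proof.
elim: s m => [|y s IH] m m0 /=; first by rewrite inE; lia.
rewrite inE negb_or => /andP[y0 s0]; case: ifP => my.
  by rewrite inE negb_or IH // andbT; lia.
by rewrite !inE !negb_or y0 s0 andbT; lia.
Qed.

Lemma sumn_pop m s : bead m s -> sumn (pop m s) + m = sumn s.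
Proof.
elim: s m => //= y s IH m; case: ifP => [my /IH <-|_ /eqP ->] /=; lia.
Qed.

Lemma sumn_push m s : sumn (push m s) = sumn s + m.
Proof. by elim: s m => [|y s IH] m /=; [lia|case: ifP => my /=; rewrite ?IH;
  lia]. Qed.

Lemma bead_pop m s : sorted geq s -> bead m s -> ~~ bead m.+1 (pop m s).
Proof.
elim: s m => //= y s IH m ys; case: ifP => [my|_ /eqP ym] /=.
  by rewrite ltnS my; apply: IH; apply: path_sorted ys.
by rewrite (bead_lt ys) // ym.
Qed.

Lemma bead_push m s : ~~ bead m.+1 s -> bead m (push m s).
Proof.
elim: s m => [|y s IH] m /=; first by rewrite ltnn eqxx.
case: ifP => [my /IH|_ _] /=; last by rewrite ltnn eqxx.
by rewrite ifT //; lia.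
Qed.

Lemma popK m s : sorted geq s -> bead m s -> push m (pop m s) = s.
Proof.
elim: s m => //= y s IH m ys; case: ifP => [my nb|_ /eqP ym] /=.
  by rewrite ltnS my IH //; apply: path_sorted ys.
by rewrite -ym; case: s ys {IH} => //= z s /andP[/= zy _]; rewrite ifF //; lia.
Qed.

Lemma pushK m s : ~~ bead m.+1 s -> pop m (push m s) = s.
Proof.
elim: s m => [|y s IH] m /=; first by rewrite ltnn.
case: ifP => [my /IH|_ _] /=; last by rewrite ltnn.
by move=> e; rewrite ifT ?e ?prednK //; lia.
Qed.

(** [pop m] is a bijection onto the partitions of [N - m] without a bead at [m + 1]; the second
    summand counts those with one. *)
Lemma num_bead_rec (m N : nat) : 0 < m -> m <= N ->
  num_intpart N (bead m) + num_intpart (N - m) (bead m.+1) = npart (N - m).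
Proof.
move=> m0 mN; rewrite (npartID _ (bead m.+1)) addnC; congr (_ + _).
apply: (@eq_num_intpart_bij _ _ _ _ (pop m) (push m)) => s.
  case/and3P=> s_s s0 /eqP sN bs; split; last exact: popK.
    apply/and3P; split; [|exact: pop_neq0|by have := sumn_pop bs; lia].
    case: s s_s {s0 sN bs} => //= x s xs; case: ifP => _ /=.
      exact: path_pop.
    exact: path_sorted xs.
  exact: bead_pop.
case/and3P=> s_s s0 /eqP sN bs; split; last exact: pushK.
  apply/and3P; split; [|exact: push_neq0|by rewrite sumn_push; lia].
  case: s s_s bs {s0 sN} => //= x s xs.
  case: ifP => [mx nb|mx nb] /=; first by apply: path_push xs _ nb; lia.
  by rewrite xs andbT; lia.
exact: bead_push.
Qed.

Lemma num_bead_gt (m N : nat) : N < m -> num_intpart N (bead m) = 0.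
Proof.
move=> Nm; apply: num_intpart_eq0 => s /and3P[s_s _ /eqP sN].
case: s s_s sN => //= x s xs sN; rewrite ifF; lia.
Qed.

Lemma sorted_rcons_geq1 s : sorted geq s -> 0 \notin s ->
  sorted geq (rcons s 1).
Proof.
case: s => //= x s; rewrite inE negb_or rcons_path => -> /andP[x0 s0].
have := mem_last x s; rewrite inE => /orP[/eqP-> /=|ls]; first by lia.
rewrite /= lt0n; apply: contra s0 => /eqP <- //.
Qed.

Lemma bead_rcons m s : bead m s -> bead m (rcons s 1).
Proof. by elim: s m => //= x s IH m; case: ifP => // _ /IH. Qed.

(** Appending a part 1 does not change the index of any earlier part. *)
Lemma num_bead_homo (m N : nat) :
  num_intpart N (bead m) <= num_intpart N.+1 (bead m).
Proof.
apply: (@leq_num_intpart _ _ _ _ (fun s => rcons s 1) (fun s =>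
  take (size s).-1 s)).
move=> s /and3P[s_s s0 /eqP sN] bs; split; last 2 first.
- exact: bead_rcons.
- by rewrite size_rcons -cats1 take_size_cat.
apply/and3P; split; first exact: sorted_rcons_geq1.
  by rewrite mem_rcons inE negb_or.
by rewrite -cats1 sumn_cat sN /= addn0 addn1.
Qed.

Lemma leq_num_bead (m N N' : nat) : N <= N' ->
  num_intpart N (bead m) <= num_intpart N' (bead m).
Proof.
move=> /subnKC <-; elim: (N' - N) => [|k IH]; first by rewrite addn0.
by rewrite addnS; apply: leq_trans IH (num_bead_homo _ _).
Qed.

(** * Cranks *)

(** For nonincreasing [s] this is the height [d] of the Durfee rectangle with [d] rows and
    [d + m - 1] columns. *)
Fixpoint lead_count (m : nat) (s : seq nat) : nat :=
  if s is x :: s' then if m <= x then (lead_count m.+1 s').+1 else 0 else 0.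

(** Beads at positions at least [m] move up by one, which vacates [m]; [lead_decr] moves those above
    [m] back down and so requires [m] to be vacant. *)
Fixpoint lead_incr (m : nat) (s : seq nat) : seq nat :=
  if s is x :: s' then if m <= x then x.+1 :: lead_incr m.+1 s' else s else
    [::].

Fixpoint lead_decr (m : nat) (s : seq nat) : seq nat :=
  if s is x :: s' then if m < x then x.-1 :: lead_decr m.+1 s' else s else [::].

(** As [s_i - i] strictly decreases, the index [k] alone decides whether the leading run has
    stopped. With [0 < m] the default value 0 also stops it. *)
Lemma lead_count_le m s k : sorted geq s -> 0 < m ->
  (lead_count m s <= k) = (nth 0 s k < k + m).
Proof.
elim: s m k => [|x s IH] m k; first by rewrite nth_nil /=; lia.
move=> /= xs m0; case: k => [|k]; rewrite ?addSn ?ltnS /=; case: ifP => mx.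
- lia.
- lia.
- by rewrite ltnS IH ?(path_sorted xs) // addnS ltnS.
suff: nth 0 s k <= x by lia.
case: (ltnP k (size s)) => ks; last by rewrite nth_default.
exact: (allP (order_path_min (fun a b c ab bc =>
  leq_trans bc ab) xs)) _ (mem_nth 0 ks).
Qed.

Lemma sumn_lead_incr m s : sumn (lead_incr m s) = sumn s + lead_count m s.
Proof. by elim: s m => //= x s IH m; case: ifP => _ //=; rewrite ?IH; lia. Qed.

Lemma sumn_lead_decr m s : sumn (lead_decr m s) + lead_count m.+1 s = sumn s.
Proof. by elim: s m => //= x s IH m; case: ifP => mx //=; rewrite -?(IH m.+1);
  lia. Qed.

Lemma lead_count_incr m s : lead_count m.+1 (lead_incr m s) = lead_count m s.
Proof.
elim: s m => //= x s IH m; case: ifP => mx /=; first by rewrite ltnS mx IH.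
by rewrite ifF //; lia.
Qed.

Lemma lead_count_decr m s : ~~ bead m s ->
  lead_count m (lead_decr m s) = lead_count m.+1 s.
Proof.
elim: s m => //= x s IH m; case: ifP => mx nb /=; last by rewrite ifF //; lia.
by rewrite ifT ?IH //; lia.
Qed.

Lemma lead_incrK m s : lead_decr m (lead_incr m s) = s.
Proof.
elim: s m => //= x s IH m; case: ifP => mx /=; first by rewrite ltnS mx IH.
by rewrite ifF //; lia.
Qed.

Lemma lead_decrK m s : ~~ bead m s -> lead_incr m (lead_decr m s) = s.
Proof.
elim: s m => //= x s IH m; case: ifP => mx nb /=; last by rewrite ifF //; lia.
by rewrite ifT ?IH ?prednK //; lia.
Qed.

Lemma bead_lead_incr m s : sorted geq s -> ~~ bead m (lead_incr m s).
Proof.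
elim: s m => //= x s IH m xs; case: ifP => mx /=.
  by rewrite ltnS mx IH // (path_sorted xs).
by rewrite ifF; lia.
Qed.

Lemma path_lead_incr m x s : path geq x s ->
  path geq (x + (0 < lead_count m s)) (lead_incr m s).
Proof.
elim: s m x => //= y s IH m x /andP[yx ys]; case: ifP => my /=;
  last by rewrite ys andbT; lia.
rewrite addn1 ltnS yx /=; apply: path_geqW (IH m.+1 y ys) _ _.
by case: (0 < _); lia.
Qed.

Lemma path_lead_decr m x s :
  path geq x s -> m < x -> ~~ bead m.+1 s -> path geq x.-1 (lead_decr m.+1 s).
Proof.
elim: s m x => //= y s IH m x /andP[yx ys] mx; case: ifP => my nb /=.
  by rewrite IH // andbT; lia.
by rewrite ys andbT; lia.
Qed.

Lemma lead_incr_neq0 m s : 0 \notin s -> 0 \notin lead_incr m s.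
Proof.
elim: s m => //= y s IH m; rewrite inE negb_or => /andP[y0 s0].
by case: ifP => my; rewrite inE negb_or /= ?IH ?y0.
Qed.

Lemma lead_decr_neq0 m s : 0 < m -> 0 \notin s -> 0 \notin lead_decr m s.
Proof.
elim: s m => //= y s IH m m0; rewrite inE negb_or => /andP[y0 s0].
case: ifP => my; rewrite inE negb_or ?IH ?y0 //= andbT; lia.
Qed.

Lemma lead_count_head m s : 0 < lead_count m s -> m <= head 0 s.
Proof. by case: s => //= x s; case: ifP. Qed.

(* A partition of crank smaller than [m] having [o > 0] ones and more than [m]
   parts, once conjugated, is a partition [y :: s] with
   [o = y - head 0 s] and [nth 0 (y :: s) o < o + m]. *)
Lemma num_small_crank_conj (m N : nat) :
  num_intpart N (fun s => if s is y :: s' then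
      (m < y) && (lead_count m.+1 s' < y - head 0 s') else false) =
  num_intpart N (fun s => (m < head 0 s) && ~~ bead m s).
Proof.
(* The first part pays for the units added to the leading run of the others. The length of that run
   is read off again at level [m + 2]. *)
apply: (@eq_num_intpart_bij _ _ _ _
  (fun s => if s is y :: s' then y - lead_count m.+1 s' :: lead_incr m.+1 s'
    else s)
  (fun s => if s is y :: s' then y + lead_count m.+2 s' :: lead_decr m.+1 s'
    else s)).
  case=> // y s /and3P[/= ys]; rewrite inE negb_or => /andP[y0 s0] /eqP sN.
  case/andP=> my Ty; have Th := @lead_count_head m.+1 s.
  have s_s := path_sorted ys.
  (* If the run is nonempty, [head 0 s] exceeds [m], and the hypothesis keeps the reduced first part
     above [head 0 s]. *)
  have my' : m < y - lead_count m.+1 s by case: (posnP (lead_count m.+1 s)) =>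
    [|/Th]; lia.
  rewrite my' bead_lead_incr //; split=> //; last first.
    by rewrite lead_count_incr lead_incrK subnK //; lia.
  apply/and3P; split=> /=.
  - apply: path_geqW (@path_lead_incr _ (head 0 s) _ _) _ _.
      by case: s s_s {ys s0 sN Ty Th my'} => //= z s ->; rewrite andbT; lia.
    by case: (posnP (lead_count m.+1 s)); lia.
  - by rewrite inE negb_or lead_incr_neq0 // andbT; lia.
  - by rewrite sumn_lead_incr; lia.
case=> // y s /and3P[/= ys]; rewrite inE negb_or => /andP[y0 s0] /eqP sN.
case/andP=> my; rewrite my => nb; have pd := path_lead_decr ys my nb.
have hd : head 0 (lead_decr m.+1 s) < y by case: lead_decr pd =>
  /= [|z u /andP[]]; lia.
rewrite lead_count_decr //; split; last by rewrite lead_decrK // addnK.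
  apply/and3P; split=> /=.
  - by apply: path_geqW pd _ _; lia.
  - by rewrite inE negb_or lead_decr_neq0 // andbT; lia.
  - by have := sumn_lead_decr m.+1 s; lia.
by apply/andP; split; lia.
Qed.

(** * Conjugation of partitions *)

Definition conjp (s : seq nat) : seq nat :=
  mkseq (fun j => count (ltn j) s) (head 0 s).

Lemma geq_head s x : sorted geq s -> x \in s -> x <= head 0 s.
Proof.
case: s => //= y s ys; rewrite inE => /orP[/eqP -> //|xs].
by apply: (allP (order_path_min _ ys)) xs => a b c ab bc;
  apply: leq_trans bc ab.
Qed.

(** The parts larger than [j] form a prefix; both sides say that the cell [(i, j)] lies in the
    Ferrers diagram. *)
Lemma ltn_count s i j : sorted geq s -> (i < count (ltn j) s) = (j < nth 0 s i).
Proof.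
elim: s i => [|x s IH] i; first by rewrite nth_nil ltn0.
move=> /= xs; have s_s := path_sorted xs.
case: (ltnP j x) => jx; first by case: i => [|i] /=; rewrite ?jx // -IH.
have s0 : count (ltn j) s = 0.
  apply/eqP; rewrite -leqn0 leqNgt -has_count; apply/hasP => -[y ys /= jy].
  by have := geq_head (s := x :: s) xs (mem_behead (s := x :: s) ys);
    rewrite /=; lia.
case: i => [|i] /=; first by rewrite s0; lia.
by rewrite s0 -IH // s0.
Qed.

Lemma nth_conjp s j : sorted geq s -> nth 0 (conjp s) j = count (ltn j) s.
Proof.
move=> s_s; case: (ltnP j (head 0 s)) => jh; first by rewrite nth_mkseq.
rewrite nth_default ?size_mkseq //; apply/esym/eqP.
by rewrite -leqn0 leqNgt ltn_count // nth0; lia.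
Qed.

(** Cells are counted by columns: a part [x] contributes once for each [j < x], and [h] bounds all
    parts. *)
Lemma sumn_mkseq_count s h : all (geq h) s ->
  sumn (mkseq (fun j => count (ltn j) s) h) = sumn s.
Proof.
rewrite /mkseq; elim: s => [|x s IH] /=.
  by move=> _; elim: (iota 0 h) => //= a l ->.
case/andP=> xh /IH <-;
  have {2}-> : x = sumn [seq (j < x : nat) | j <- iota 0 h].
  rewrite sumn_count -(subnKC xh) iotaD count_cat.
  rewrite (eq_in_count (a2 := predT)) => [|j];
    last by rewrite mem_iota => /andP[].
  rewrite count_predT size_iota (eq_in_count (a2 := pred0)) ?count_pred0 ?addn0
    //.
  by move=> j; rewrite mem_iota /=; lia.
by elim: (iota 0 h) => //= a l ->; lia.
Qed.

Lemma conjp_intpart N s : is_intpart N s -> is_intpart N (conjp s).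
Proof.
case/and3P=> s_s s0 /eqP <-; apply/and3P; split.
- apply: (@path_sorted _ _ (size s)); apply/(pathP 0) => i.
  rewrite size_mkseq => ih; rewrite nth_mkseq //=.
  case: i ih => [|i] ih; first exact: count_size.
  by rewrite /= nth_mkseq ?(ltnW ih) //; apply: sub_count => x /= /ltnW.
- apply/mapP => -[j]; rewrite mem_iota => /andP[_ jh] /esym/eqP.
  by rewrite -leqn0 leqNgt ltn_count // nth0; lia.
- rewrite sumn_mkseq_count //; apply/allP => x; exact: geq_head.
Qed.

Lemma conjpK N s : is_intpart N s -> conjp (conjp s) = s.
Proof.
move=> sN; have /and3P[c_s c0 _] := conjp_intpart sN.
case/and3P: sN => s_s s0 _.
have h : head 0 (conjp s) = size s.
  rewrite -nth0 nth_conjp //; apply/eqP; rewrite -all_count;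
    apply/allP => x xs /=.
  by rewrite lt0n; apply: contraNneq s0 => <-.
apply: (@eq_from_nth _ 0); first by rewrite size_mkseq.
rewrite size_mkseq h => i si; rewrite nth_mkseq ?h //.
apply/eqP; rewrite eqn_leq; apply/andP; split.
  by rewrite leqNgt ltn_count // nth_conjp // ltn_count // ltnn.
case E: (nth 0 s i) => [//|n].
by rewrite ltn_count // nth_conjp // ltn_count // E.
Qed.

Lemma num_conjp N (P : pred (seq nat)) :
  num_intpart N (fun s => P (conjp s)) = num_intpart N P.
Proof.
apply: (@eq_num_intpart_bij _ _ _ _ conjp conjp) => s sN Ps.
  by split; rewrite ?(conjpK sN) //; apply: conjp_intpart.
by split; rewrite ?(conjpK sN) //; apply: conjp_intpart.
Qed.

Lemma largest_part_head s : sorted geq s -> largest_part s = head 0 s.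
Proof.
move=> s_s; apply/eqP; rewrite eqn_leq; apply/andP; split.
  by apply/bigmax_leqP_seq => i si _; apply: geq_head.
by case: s s_s => //= x s _; rewrite /largest_part big_cons leq_maxl.
Qed.

Lemma ones_conjp s : sorted geq s -> 0 \notin s ->
  ones s = nth 0 (conjp s) 0 - nth 0 (conjp s) 1.
Proof.
move=> s_s s0; rewrite !nth_conjp // /ones.
elim: s s0 {s_s} => //= x s IH; rewrite inE negb_or => /andP[x0 /IH ->].
have : count (ltn 1) s <= count (ltn 0) s by apply: sub_count => y /=; lia.
by case: x x0 => [|[|x]] //= _; lia.
Qed.

Lemma mu_conjp s : sorted geq s -> mu s = nth 0 (conjp s) (ones s).
Proof. by move=> s_s; rewrite nth_conjp. Qed.

(** * Partitions of crank at least [m] and partitions with a bead at [m] *)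

Definition crank_lt (m : nat) (s : seq nat) : bool :=
  if ones s == 0 then head 0 s < m else mu s < ones s + m.

Lemma crank_ltP m N s : is_intpart N s ->
  (part_crank s < m%:Z)%R = crank_lt m s.
Proof.
case/and3P=> s_s _ _; rewrite /part_crank /crank_lt largest_part_head //.
by case: ifP => _; lia.
Qed.

Lemma sorted_ones s : sorted geq s -> 0 \notin s -> ones s != 0 ->
  exists2 s', s = rcons s' 1 & s' = take (size s).-1 s.
Proof.
case/lastP: s => //= s x s_s s0 o0; exists s; last first.
  by rewrite size_rcons -cats1 take_size_cat.
congr rcons; apply/eqP; apply: contraR o0 => x1; apply/eqP/count_memPn.
rewrite mem_rcons inE negb_or eq_sym x1; apply/negP => s1.
have x0 : x != 0 by apply: contraNneq s0 => ->; rewrite mem_rcons mem_head.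
have /= : all (leq x) s.
  move: s_s; rewrite -(rev_sorted) rev_rcons /= => /order_path_min H.
  rewrite -all_rev; apply: sub_all (H _) => [y|] //=.
  by move=> a b c; apply: leq_trans.
by move/allP/(_ _ s1); lia.
Qed.

(** Drop a last part 1: as [1 < N], another part remains and the largest part is unchanged. *)
Lemma num_head_lt_ones m N : 1 < N ->
  num_intpart N (fun s => (head 0 s < m) && ~~ (ones s == 0)) =
  num_intpart N.-1 (fun s => head 0 s < m).
Proof.
move=> N1; apply: (@eq_num_intpart_bij _ _ _ _
  (fun s => take (size s).-1 s) (fun s => rcons s 1)).
  move=> s /and3P[s_s s0 /eqP sN] /andP[hm o0].
  have [s' Es <-] := sorted_ones s_s s0 o0; split=> //.
    apply/and3P; split.
    - by move: s_s; rewrite Es -cats1 => /cat_sorted2[].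
    - by move: s0; rewrite Es mem_rcons inE negb_or => /andP[].
    - by move: sN; rewrite Es sumn_rcons; lia.
  by move: hm sN; rewrite Es; case: s' {Es} => //=; lia.
move=> s /and3P[s_s s0 /eqP sN] hm; split.
- apply/and3P; split; first exact: sorted_rcons_geq1.
    by rewrite mem_rcons inE.
  by rewrite sumn_rcons; lia.
- have -> : head 0 (rcons s 1) = head 0 s by case: s sN {s_s s0 hm} => //=; lia.
  by rewrite hm /ones -cats1 count_cat /= addn1.
- by rewrite size_rcons -cats1 take_size_cat.
Qed.

(** Lower the strictly largest part by one. The target is that of [num_head_lt_ones], which equates
    two classes in [num_crank_lt]. *)
Lemma num_head_gt m N : 1 < N ->
  num_intpart N (fun s => (nth 0 s 1 < head 0 s) && (head 0 s <= m)) =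
  num_intpart N.-1 (fun s => head 0 s < m).
Proof.
move=> N1; apply: (@eq_num_intpart_bij _ _ _ _
  (fun s => if s is x :: s' then x.-1 :: s' else s)
  (fun s => if s is x :: s' then x.+1 :: s' else s)).
  case=> // x s /and3P[/= xs]; rewrite inE negb_or => /andP[x0 s0] /eqP sN.
  case/andP => /= hx xm; split; [|lia|by rewrite prednK //; lia].
  apply/and3P; split=> /=; [|rewrite inE negb_or (negbTE s0) andbT|lia].
    by case: s xs s0 hx {sN} => //= y s /andP[_ ->] _; rewrite andbT; lia.
  by case: s s0 hx sN {xs} => [|y s] /=; rewrite ?inE ?negb_or; lia.
case=> [|x s] /and3P[/= xs]; first by move=> _ /eqP; lia.
rewrite inE negb_or => /andP[x0 s0] /eqP sN hx; split=> //.
  apply/and3P; split=> /=; [|by rewrite inE|by apply/eqP; lia].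
  by apply: path_geqW xs _ _.
by rewrite hx andbT; case: s xs {s0 sN} => //= y s /andP[/= yx _]; rewrite ltnS.
Qed.

(** A first part equal to [m] is a bead at index 0, so without a bead the first part is above or
    below [m]. The crank side splits by the presence of ones; its class with ones is conjugated,
    then split by whether the first part exceeds [m]. *)
Lemma num_crank_lt m N : 0 < m -> 1 < N ->
  num_intpart N (crank_lt m) = num_intpart N (predC (bead m)).
Proof.
move=> m0 N1.
have -> : num_intpart N (predC (bead m)) =
    num_intpart N (fun s => (m < head 0 s) && ~~ bead m s) +
    num_intpart N (fun s => head 0 s < m).
  rewrite (num_intpartID N _ (fun s => m < head 0 s)); congr (_ + _).
    by apply: eq_num_intpart => s _ /=; rewrite andbC.
  apply: eq_num_intpart => s /and3P[s_s _ /eqP sN].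
  case: s s_s sN => /= [|x s] xs sN; first by lia.
  by case: ltnP => //= xm; lia.
rewrite (num_intpartID N _ (fun s => ones s == 0)).
rewrite (num_intpartID N (fun s => head 0 s < m) (fun s => ones s == 0)).
rewrite num_head_lt_ones // -num_head_gt // -num_small_crank_conj.
(* The condition of crank below [m] with some ones, read on the conjugate: the number of ones is the
   first part minus the second, and [mu] is the part at that index. *)
pose P s := (nth 0 s 1 < head 0 s) &&
  (nth 0 s (head 0 s - nth 0 s 1) < head 0 s - nth 0 s 1 + m).
have -> : num_intpart N (fun s =>
  crank_lt m s && ~~ (ones s == 0)) = num_intpart N P.
  rewrite -[RHS]num_conjp; apply: eq_num_intpart => s /and3P[s_s s0 _].
  rewrite /crank_lt /P -(nth0 0 (conjp s)) -ones_conjp // -mu_conjp //.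
  rewrite -(subn_gt0 (nth 0 (conjp s) 1)) -ones_conjp //.
  by case: (ones s) => [|o]; rewrite ?andbF ?andbT.
rewrite (num_intpartID N P (fun s => m < head 0 s)) addnC -addnA; congr (_ + _).
  apply: eq_num_intpart => s /and3P[s_s s0 /eqP sN].
  case: s s_s s0 sN => [|y s] /= ys _ sN; first by [].
  have n1 : nth 0 (y :: s) 1 = head 0 s by rewrite -nth0.
  rewrite /P n1; case: (ltnP (head 0 s)) => /= hy; last by lia.
  have -> : y - head 0 s = (y - head 0 s).-1.+1 by lia.
  by rewrite ltnS lead_count_le ?(path_sorted ys) //= addSnnS andbC.
rewrite addnC; congr (_ + _).
  by apply: eq_num_intpart => s _; rewrite /crank_lt; case: ifP; rewrite ?andbF.
(* With first part at most [m], the second clause of [P] is automatic: the part in question is at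
   most the second part, which is below [m]. *)
apply: eq_num_intpart => s /and3P[s_s s0 /eqP sN].
rewrite /P -leqNgt; case: (ltnP (nth 0 s 1)) => //= h1.
case: (leqP (head 0 s)) => hm; rewrite ?andbF // andbT.
case: s s_s h1 hm {s0 sN} => //= y s ys; rewrite nth0 => h1 hm.
have -> : y - head 0 s = (y - head 0 s).-1.+1 by lia.
apply: (@leq_ltn_trans (head 0 s)); last by lia.
have [ks|ks] := ltnP (y - head 0 s).-1 (size s); last by rewrite /= nth_default.
by apply: geq_head (path_sorted ys) (mem_nth 0 ks).
Qed.

Lemma num_crank_ge m N : 0 < m -> 1 < N ->
  num_intpart N (fun s => (m%:Z <= part_crank s)%R) = num_intpart N (bead m).
Proof.
move=> m0 N1; have := npartID N (bead m); rewrite -num_crank_lt // => E.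
have := npartID N (crank_lt m); rewrite E addnC => /addnI ->.
by apply: eq_num_intpart => s sN; rewrite /= -(crank_ltP _ sN) leNgt.
Qed.

Lemma crank_countE m N : 0 < m -> N != 1 ->
  num_intpart N (bead m) = num_intpart N (bead m.+1) + num_intpart N (fun s =>
    part_crank s == Posz m).
Proof.
move=> m0; case: N => [|[|N]] // _.
  rewrite !num_bead_gt // num_intpart_eq0 // => -[|x s] /and3P[_ s0 /eqP sN].
    by rewrite /part_crank /largest_part big_nil /=; lia.
  by move: s0 sN; rewrite inE negb_or /=; lia.
rewrite -!num_crank_ge // (num_intpartID _ _ (fun s =>
  (m.+1%:Z <= part_crank s)%R)).
by congr (_ + _); apply: eq_num_intpart => s _ /=; lia.
Qed.

(** The difference counts the partitions of crank [m], except at [N = 1], where no bead lies above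
    position 1. *)
Lemma leq_num_bead_level m N : 0 < m ->
  num_intpart N (bead m.+1) <= num_intpart N (bead m).
Proof.
move=> m0; case: (N =P 1) => [->|/eqP N1]; first by rewrite num_bead_gt.
by rewrite (crank_countE m0 N1) leq_addr.
Qed.

(** * Ranks *)

Definition add_column (k : nat) (s : seq nat) : seq nat :=
  map succn s ++ nseq (k - size s) 1.

Definition del_column (s : seq nat) : seq nat := [seq x.-1 | x <- s & 1 < x].

Lemma size_add_column k s : size s <= k -> size (add_column k s) = k.
Proof. by move=> sk; rewrite size_cat size_map size_nseq subnKC. Qed.

Lemma path_add_column k x s : path geq x s -> path geq x.+1 (add_column k s).
Proof.
rewrite /add_column; elim: s k x => [|y s IH] k x /=.
  by rewrite subn0 => _; elim: k x => //= k IH x; rewrite IH.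
by case/andP=> yx ys; rewrite ltnS yx; case: k => [|k]; rewrite ?subSS;
  apply: (IH 0) || apply: IH.
Qed.

Lemma sumn_add_column k s : size s <= k -> sumn (add_column k s) = sumn s + k.
Proof.
move=> sk; rewrite sumn_cat sumn_nseq mul1n.
have -> : sumn (map succn s) = sumn s + size s by elim: s {sk} => //= y s ->;
  lia.
by rewrite -addnA subnKC.
Qed.

Lemma add_column_neq0 k s : 0 \notin add_column k s.
Proof.
rewrite mem_cat negb_or mem_nseq andbF andbT.
by apply/negP => /mapP[].
Qed.

Lemma add_columnK k s : 0 \notin s -> del_column (add_column k s) = s.
Proof.
move=> s0; rewrite /del_column filter_cat map_cat.
have -> : [seq x <- nseq (k - size s) 1 | 1 < x] = [::] by elim: (k - _).
rewrite cats0; elim: s s0 => //= y s IH; rewrite inE negb_or => /andP[y0 s0].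
by rewrite ltnS lt0n eq_sym y0 /= IH.
Qed.

Lemma path_del_column x s : path geq x s -> path geq x.-1 (del_column s).
Proof.
rewrite /del_column; elim: s x => //= y s IH x /andP[yx ys].
case: ifP => y1 /=; first by rewrite IH // andbT; lia.
by apply: path_geqW (IH _ ys) _ _; lia.
Qed.

Lemma del_column_neq0 s : 0 \notin del_column s.
Proof. by apply/negP => /mapP[x]; rewrite mem_filter => /andP[]; lia. Qed.

Lemma sumn_del_column s : 0 \notin s -> sumn (del_column s) + size s = sumn s.
Proof.
rewrite /del_column; elim: s => //= y s IH;
  rewrite inE negb_or => /andP[y0 /IH].
by case: ifP => y1 /=; lia.
Qed.

Lemma path_geq1_nseq s : path geq 1 s -> 0 \notin s -> s = nseq (size s) 1.
Proof.
elim: s => //= y s IH /andP[/= y1 ys]; rewrite inE negb_or => /andP[y0 s0].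
have y11 : y = 1 by lia.
by rewrite y11 -IH // -y11.
Qed.

Lemma del_columnK s : sorted geq s -> 0 \notin s ->
  add_column (size s) (del_column s) = s.
Proof.
rewrite /add_column; elim: s => //= y s IH ys;
  rewrite inE negb_or => /andP[y0 s0].
rewrite /del_column /=; case: ifP => y1 /=.
  by rewrite subSS IH ?(path_sorted ys) // prednK //; lia.
have y11 : y = 1 by lia.
rewrite y11 in ys *; have Es := path_geq1_nseq ys s0.
have -> : [seq x <- s | 1 < x] = [::] by rewrite Es; elim: (size s).
by rewrite /= -Es.
Qed.

Lemma size_del_column s : size (del_column s) <= size s.
Proof. by rewrite size_map size_filter count_size. Qed.

(* Dyson's adjoint: remove the largest part and add a first column whose
   length is the largest part minus [m.+1]. *)
Lemma num_rank_rec (m N : nat) : 0 < m -> m < N ->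
  num_intpart N (fun s => m + size s <= head 0 s) +
  num_intpart (N - m.+1) (fun s =>
    m + 3 + size s <= head 0 s) = npart (N - m.+1).
Proof.
move=> m0 mN; rewrite (npartID _ (fun s => m + 3 + size s <= head 0 s)) addnC.
congr (_ + _); apply: (@eq_num_intpart_bij _ _ _ _
  (fun s => if s is x :: s' then add_column (x - m.+1) s' else s)
  (fun s => (size s + m.+1) :: del_column s)).
  case=> [|x s] /and3P[/= xs].
    by move=> _ /eqP; lia.
  rewrite inE negb_or => /andP[x0 s0] /eqP sN xm.
  have pa := path_add_column (x - m.+1) xs.
  (* Rank at least [m] says exactly that the new column covers all remaining rows. *)
  have sx : size s <= x - m.+1 by lia.
  rewrite /is_intpart sumn_add_column // add_columnK // size_add_column //;
    split.
  - by rewrite (path_sorted pa) add_column_neq0 /=; lia.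
  (* The new first part is at most [x + 1] and there are [x - m.+1] parts, so the rank is below
     [m + 3]. *)
  - by rewrite -ltnNge; case: (add_column _ _) pa => /= [|y u /andP[/=]]; lia.
  - by congr (_ :: _); lia.
move=> s /and3P[s_s s0 /eqP sN]; rewrite /= -ltnNge => hs; split; last first.
- by rewrite addnK del_columnK.
- by have := size_del_column s; lia.
apply/and3P; split; last first.
- rewrite (_ : sumn _ = size s + m.+1 + sumn (del_column s)) //.
  by rewrite addnAC (addnC (size s)) sumn_del_column // sN subnK.
- by rewrite inE negb_or del_column_neq0 andbT; lia.
rewrite [sorted _ _]/(path _ _ _); apply: (@path_geqW (head 0 s).-1);
  last by lia.
by apply: path_del_column; case: s s_s {s0 sN hs} => //= y s ->; rewrite leqnn.
Qed.

Lemma num_rank_gt (m N : nat) : 0 < m -> N <= m ->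
  num_intpart N (fun s => m + size s <= head 0 s) = 0.
Proof.
move=> m0 Nm; apply: num_intpart_eq0 => -[|x s] /and3P[_ _ /eqP /= sN]; lia.
Qed.

Lemma rank_countE (m N : nat) :
  num_intpart N (fun s => m + size s <= head 0 s) =
  num_intpart N (fun s => m.+1 + size s <= head 0 s) +
  num_intpart N (fun s => part_rank s == Posz m).
Proof.
rewrite (num_intpartID _ _ (fun s => m.+1 + size s <= head 0 s)).
congr (_ + _); apply: eq_num_intpart => s /and3P[s_s _ _]; first by lia.
by rewrite /part_rank largest_part_head //; lia.
Qed.

Local Open Scope ring_scope.

(** * Comparison of rank and crank *)

(** Extension by 0 to negative sizes makes the two recurrences valid for every integer size. *)
Definition intext (f : nat -> nat) (n : int) : int :=
  if n is Posz k then (f k)%:Z else 0.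

Lemma intext_lt0 f (n : int) : n < 0 -> intext f n = 0.
Proof. by case: n. Qed.

Lemma intext_ge0 f (n : int) : 0 <= intext f n.
Proof. by case: n. Qed.

Definition npartz : int -> int := intext npart.
Definition beadz (m : nat) : int -> int := intext (fun N =>
  num_intpart N (bead m)).
Definition rankz (m : nat) : int -> int :=
  intext (fun N => num_intpart N (fun s => (m + size s <= head 0 s)%N)).

Lemma beadz_rec (m : nat) (n : int) : (0 < m)%N ->
  beadz m n + beadz m.+1 (n - m%:Z) = npartz (n - m%:Z).
Proof.
move=> m0; case: n => [N|k]; last first.
  have neg : Negz k - m%:Z < 0 by lia.
  by rewrite /npartz /beadz !(intext_lt0 _ neg) intext_lt0.
case: (leqP m N) => mN.
  by rewrite subzn // /beadz /npartz /= -num_bead_rec.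
have neg : N%:Z - m%:Z < 0 by lia.
by rewrite /npartz /beadz !(intext_lt0 _ neg) /= num_bead_gt.
Qed.

Lemma rankz_rec (m : nat) (n : int) : (0 < m)%N ->
  rankz m n + rankz (m + 3)%N (n - m.+1%:Z) = npartz (n - m.+1%:Z).
Proof.
move=> m0; case: n => [N|k]; last first.
  have neg : Negz k - m.+1%:Z < 0 by lia.
  by rewrite /npartz /rankz !(intext_lt0 _ neg) intext_lt0.
case: (ltnP m N) => mN.
  by rewrite subzn // /rankz /npartz /= -num_rank_rec.
have neg : N%:Z - m.+1%:Z < 0 by lia.
by rewrite /npartz /rankz !(intext_lt0 _ neg) /= num_rank_gt.
Qed.

Lemma ler_beadz (s s' : nat) (n n' : int) : (0 < s <= s')%N -> n' <= n ->
  beadz s' n' <= beadz s n.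
Proof.
case/andP=> s0 ss' n'n; case: n' n'n => [N'|k] n'n; last exact: intext_ge0.
case: n n'n => [N|//]; rewrite !lez_nat /= => n'n.
apply: leq_trans (leq_num_bead _ n'n) _.
rewrite -(subnKC ss'); elim: (s' - s)%N => [|k IH]; first by rewrite addn0.
by rewrite addnS; apply: leq_trans (leq_num_bead_level _ _) IH;
  rewrite addn_gt0 s0.
Qed.

(* The alternating sum over [j < f] of
   [beadz (s + 2 j) (n - j m - j (3 j - 1) / 2)]. *)
Fixpoint bead_alt (f m s : nat) (n : int) : int :=
  if f is f'.+1 then
    beadz s n - bead_alt f' (m + 3)%N (s + 2)%N (n - m.+1%:Z)
  else 0.

(** The first [f] terms of the iteration of [rankz_rec]. Each step lowers [n] by at least one, so
    the expansion is exact once [n < f]. *)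
Fixpoint rank_alt (f m : nat) (n : int) : int :=
  if f is f'.+1 then
    npartz (n - m.+1%:Z) - rank_alt f' (m + 3)%N (n - m.+1%:Z)
  else 0.

Lemma bead_alt_rec f m s (n : int) :
  bead_alt f.+1 m s n = beadz s n - bead_alt f (m + 3)%N (s + 2)%N (n -
    m.+1%:Z).
Proof. by []. Qed.

Lemma rank_altE f m (n : int) : (0 < m)%N -> n < f%:Z ->
  rank_alt f m n = rankz m n.
Proof.
elim: f m n => [|f IH] m n m0 nf /=; first by rewrite /rankz intext_lt0.
by rewrite -(rankz_rec n m0) IH ?addrK //; lia.
Qed.

Lemma bead_alt_lt0 f m s (n : int) : n < 0 -> bead_alt f m s n = 0.
Proof.
elim: f m s n => [|f IH] m s n n0 //=.
by rewrite /beadz intext_lt0 // IH ?subr0 //; lia.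
Qed.

Lemma bead_altS f m s (n : int) : n < f%:Z ->
  bead_alt f.+1 m s n = bead_alt f m s n.
Proof.
elim: f m s n => [|f IH] m s n nf; first by rewrite bead_alt_lt0.
by rewrite bead_alt_rec IH //; lia.
Qed.

(** The leading terms merge by [beadz_rec] into [npartz (n - s)], and the two tails form the same
    pair with [m + 3] and [s + 2]. The crank recurrence thus produces the rank expansion. *)
Lemma bead_alt_pair f m s (n : int) : (0 < s)%N ->
  bead_alt f m.+1 s n + bead_alt f (m + 3)%N s.+1 (n - s%:Z) =
  rank_alt f m (n - s%:Z + m.+1%:Z).
Proof.
elim: f m s n => [|f IH] m s n s0 /=; first by rewrite addr0.
rewrite addrK -(beadz_rec n s0).
have := IH (m + 3)%N (s + 2)%N (n - m.+2%:Z).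
rewrite (_ : n - m.+2%:Z - (s + 2)%N%:Z = n - s%:Z - (m + 3)%N.+1%:Z);
  last by lia.
rewrite subrK addn_gt0 s0 => /(_ isT) <-.
by rewrite addSn addn2 addSn addn2 opprD addrACA.
Qed.

(** The terms decrease by [ler_beadz], so the subtracted tail lies between 0 and the leading
    term. *)
Lemma bead_alt_bounds f m s (n : int) : (0 < s)%N ->
  0 <= bead_alt f m s n <= beadz s n.
Proof.
elim: f m s n => [|f IH] m s n s0 /=; first exact: intext_ge0.
have /andP[w0 wx] := IH (m + 3)%N (s + 2)%N (n - m.+1%:Z) (ltn_addr _ s0).
have xx : beadz (s + 2)%N (n - m.+1%:Z) <= beadz s n.
  by apply: ler_beadz; lia.
by lia.
Qed.

(* The sum over [k >= m] of the number of partitions of [N] of crank at least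
   [k] minus the number of those of rank at least [k], see [crank_excessE]. *)
Definition crank_excess (m N : nat) : int := bead_alt N.+1 m m N%:Z.

Lemma crank_excess_bounds m N : (0 < m)%N ->
  0 <= crank_excess m N <= beadz m N%:Z.
Proof. exact: bead_alt_bounds. Qed.

(** Peeling the first term off [crank_excess m N] leaves the second sum of [bead_alt_pair] at
    [s = m + 1], whose first sum is [crank_excess m.+1 N]. *)
Lemma crank_excessE m N : (0 < m)%N ->
  beadz m N%:Z - rankz m N%:Z = crank_excess m N - crank_excess m.+1 N.
Proof.
move=> m0; rewrite /crank_excess -(@bead_altS N.+1 m) //; last by lia.
rewrite bead_alt_rec.
have := @bead_alt_pair N.+1 m m.+1 N%:Z isT; rewrite subrK rank_altE //;
  last by lia.
by rewrite addn2; lia.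
Qed.

Local Close Scope ring_scope.

(** * Growth of the number of partitions *)

(** Removing one copy of [m] injects the partitions of [N] containing [m] into those of [N - m]. A
    partition with at least [D] part sizes is met for at least [D] values of [m]. *)
Lemma sum_npart_ge (D N : nat) :
  D * num_intpart N (fun s => D <= size (undup s)) <=
  \sum_(1 <= m < N.+1) npart (N - m).
Proof.
pose A := [set t : N.-bseq 'I_N.+1 | is_intpart N (map val t)].
apply: (@leq_trans (\sum_(1 <= m < N.+1) \sum_(t in A) (m \in map val t)));
  last first.
  rewrite !big_nat; apply: leq_sum => m /andP[m0 mN].
  rewrite (eq_bigr (fun t : N.-bseq 'I_N.+1 =>
    if m \in map val t then 1 else 0)) => [|t _]; last by case: (m \in _).
  rewrite -big_mkcondr /= sum1dep_card.
  rewrite (_ : #|_| = num_intpart N (fun s => m \in s)); last first.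
    by apply: eq_card => t; rewrite !inE.
  apply: (@leq_num_intpart _ _ _ _ (rem m)
    (fun s => sort geq (m :: s))) => s /and3P[s_s s0 /eqP sN] ms.
  have ps := perm_to_rem ms; have tr : transitive geq by move=> a b c ab bc;
    apply: leq_trans bc ab.
  split=> //.
    apply/and3P; split.
    - exact: subseq_sorted (rem_subseq m s) s_s.
    - by apply: contra s0; apply: mem_rem.
    - by have := perm_sumn ps; rewrite /= sN; lia.
  apply: (@sorted_eq _ geq) => //; first by move=> a b; lia.
    by apply: sort_sorted => a b; lia.
  by rewrite perm_sort perm_sym.
rewrite exchange_big /= mulnC -sum_nat_const.
rewrite [leqRHS](bigID (fun t : N.-bseq 'I_N.+1 =>
  D <= size (undup (map val t)))) /=.
rewrite (eq_bigl (fun t => (t \in A) && (D <= size (undup (map val t)))));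
  last first.
  by move=> t; rewrite !inE.
apply: leq_trans (leq_addr _ _); apply: leq_sum => t.
rewrite inE => /andP[/and3P[_ s0 /eqP sN]] Dt.
apply: leq_trans Dt _; set s := map val t in s0 sN *.
have -> : \sum_(1 <= m < N.+1) (m \in s) = count (mem s) (index_iota 1 N.+1).
  by elim: (index_iota _ _) => [|x l IH]; rewrite ?big_nil // big_cons IH.
rewrite -size_filter; apply: uniq_leq_size; first exact: undup_uniq.
move=> x; rewrite mem_undup mem_filter mem_index_iota => xs /=;
  rewrite xs ltnS -sN leq_sumn // andbT.
by rewrite lt0n; apply: contra s0 => /eqP <-.
Qed.

(** The part sizes with their multiplicities, padded to [D] pairs of numbers at most [N], determine
    the partition. *)
Lemma num_few_sizes (D N : nat) :
  num_intpart N (fun s => size (undup s) < D) <= (N.+1 ^ 2) ^ D.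
Proof.
pose code (s : seq nat) : {ffun 'I_D -> 'I_N.+1 * 'I_N.+1} :=
  [ffun i : 'I_D => (inord (nth 0 (undup s) i),
    inord (count_mem (nth 0 (undup s) i) s))].
have -> : (N.+1 ^ 2) ^ D = #|[set: {ffun 'I_D -> 'I_N.+1 * 'I_N.+1}]|.
  by rewrite cardsT card_ffun card_prod !card_ord.
rewrite /num_intpart -(@card_in_imset _ _ (fun t : N.-bseq 'I_N.+1 =>
  code (map val t))); first exact/subset_leq_card/finset.subsetT.
have codeP s u x : is_intpart N s -> is_intpart N u -> size (undup s) < D ->
    code s = code u -> x \in s -> count_mem x s = count_mem x u.
  move=> /and3P[_ s0 /eqP sN] /and3P[_ u0 /eqP uN] sD /ffunP E xs.
  have xi : index x (undup s) < D.
    by apply: ltn_trans sD; rewrite index_mem mem_undup.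
  have nle v i : sumn v = N -> nth 0 (undup v) i < N.+1.
    move=> vN; have [iv|iv] := ltnP i (size (undup v));
      last by rewrite nth_default.
    by rewrite ltnS -vN leq_sumn // -mem_undup mem_nth.
  have cle v y : 0 \notin v -> sumn v = N -> count_mem y v < N.+1.
    by move=> v0 vN; rewrite ltnS -vN;
      apply: leq_trans (count_size _ _) (size_leq_sumn v0).
  move: (E (Ordinal xi)); rewrite !ffunE /= => -[/(congr1 val) + /(congr1 val)].
  rewrite /= !inordK ?nle ?cle // nth_index ?mem_undup // => <- //.
move=> t u; rewrite !inE => /andP[tN tD] /andP[uN uD] E.
apply: intpart_bseq_inj; move: tN tD uN uD E.
move: (map val t) (map val u) => {t u} s u sN sD uN uD E.
have ps : perm_eq s u.
  apply/allP => x _ /=; apply/eqP.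
  have [xs|xs] := boolP (x \in s); first exact: codeP.
  have [xu|xu] := boolP (x \in u); first by apply/esym; apply: codeP.
  by rewrite !(count_memPn _).
case/and3P: sN => s_s _ _; case/and3P: uN => u_s _ _.
by apply: (@sorted_eq _ geq) ps => // a b; lia.
Qed.

Lemma mem_maskK (T : eqType) (m : bitseq) (l : seq T) :
  uniq l -> size m = size l -> [seq x \in mask m l | x <- l] = m.
Proof.
elim: l m => [|x l IH] [|b m] //= /andP[xl ul] [sm].
congr (_ :: _).
  by case: b; rewrite ?mem_head //=; apply/negP => /mem_mask; apply/negP.
rewrite -[RHS](IH _ ul sm); apply/eq_in_map => y yl.
case: b => //=; rewrite inE; case: eqP => //= yx.
by move: yl; rewrite yx (negbTE xl).
Qed.

(** A subset of [{2, ..., r + 1}] has sum at most [r (r + 1)]; taken as set of parts and filled up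
    with ones, it is recovered by dropping the ones. *)
Lemma npart_ge_exp2 (r N : nat) : r * r.+1 <= N -> 2 ^ r <= npart N.
Proof.
move=> rN; have -> : 2 ^ r = #|[set: r.-tuple bool]|.
  by rewrite cardsT card_tuple card_bool.
pose base := iota 2 r.
have base_u : uniq base by exact: iota_uniq.
pose tail (m : bitseq) := rev (mask m base).
pose f (m : r.-tuple bool) := tail m ++ nseq (N - sumn (tail m)) 1.
have mtail m x : x \in tail m -> 1 < x.
  by rewrite mem_rev => /mem_mask; rewrite mem_iota => /andP[].
have ltail m : sumn (tail m) <= N.
  rewrite sumn_rev; apply: leq_trans rN.
  apply: (@leq_trans (sumn base)).
    have := size_iota 2 r; rewrite -/base => _;
      elim: base m {base_u tail f mtail} => [|x l IH] [|[] m] //=.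
      by rewrite leq_add2l.
    by apply: leq_trans (IH m) _; rewrite leq_addl.
  have le_sumn b l : all (geq b) l -> sumn l <= size l * b.
    by elim: l => //= x l IH /andP[/= xb /IH]; rewrite mulSn; apply: leq_add.
  rewrite -{1}(size_iota 2 r); apply: le_sumn; apply/allP => x /=.
  by rewrite mem_iota; lia.
apply: (@leq_card_num_intpart _ _ f) =>
  [m _|m m' _ _ /(congr1 (seq.filter (ltn 1)))].
  rewrite andbT; apply/and3P; split.
  - have tr : transitive geq by move=> a b c ab bc; apply: leq_trans bc ab.
    rewrite sorted_pairwise // pairwise_cat -!sorted_pairwise //; apply/and3P;
      split.
    + by apply/allrelP => x y /mtail x1;
      rewrite mem_nseq => /andP[_ /eqP ->] /=; apply: ltnW.
    + rewrite rev_sorted;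
      apply: (subseq_sorted _ (mask_subseq _ _) (iota_sorted 2 r)).
      by move=> a b c; apply: leq_trans.
    + by elim: (N - _) => //= -[|k].
  - rewrite mem_cat negb_or mem_nseq andbF andbT.
    by apply/negP => /mtail.
  - by rewrite sumn_cat sumn_nseq mul1n subnKC.
have fK m1 : [seq x <- f m1 | ltn 1 x] = tail m1.
  rewrite filter_cat (_ : [seq x <- nseq _ _ | _] = [::]);
    last by elim: (N - _).
  by rewrite cats0; apply/all_filterP/allP => x /mtail.
rewrite !fK => /(can_inj revK) E; apply: val_inj.
rewrite -(@mem_maskK _ (val m) base) ?size_iota ?size_tuple //.
by rewrite -[RHS](@mem_maskK _ (val m') base) ?size_iota ?size_tuple // E.
Qed.

Lemma poly_lt_exp2 (d : nat) : exists r0, forall r, r0 <= r ->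
  2 * r.+2 ^ d <= 2 ^ r.
Proof.
(* The exponent [e] absorbs the factor 2. The threshold gives [2 (2 e + 1) <= q], so [q < 2 ^ q]
   yields [2 (r + 2) <= 2 ^ (2 q)], to be raised to the power [e]. *)
pose e := d.+1; exists (2 * e * (2 * (2 * e).+1)) => r rr.
pose q := r %/ (2 * e).
have rq : r < 2 * e * q.+1 by rewrite mulnC ltn_ceil.
have q0 : 2 * (2 * e).+1 <= q by rewrite leq_divRL // mulnC.
have qq : q < 2 ^ q by exact: ltn_expl.
have le2 : 2 * r.+2 <= 2 ^ q * 2 ^ q.
  apply: leq_trans (leq_mul qq qq).
  apply: (@leq_trans (2 * ((2 * e).+1 * q.+1)));
    last by rewrite mulnA leq_mul // ltnW.
  by rewrite leq_mul2l /=; lia.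
apply: (@leq_trans ((2 * r.+2) ^ e)).
  by rewrite expnMn leq_mul // ?leq_pexp2l // -{1}(expn1 2) leq_pexp2l.
apply: (@leq_trans ((2 ^ q * 2 ^ q) ^ e)); first by rewrite leq_exp2r.
rewrite -expnD -expnM leq_exp2l //.
by apply: leq_trans (leq_divM r (2 * e)); rewrite -/q; lia.
Qed.

Lemma sqrt_bracket (N : nat) : exists2 r, r * r.+1 <= N & N.+1 <= r.+2 ^ 2.
Proof.
elim: N => [|N [r rN Nr]]; first by exists 0.
have [rN'|Nr'] := leqP (r.+1 * r.+2) N.+1; [exists r.+1 | exists r] => //; lia.
Qed.

Lemma few_sizes_negligible (D : nat) :
  exists n0, forall N, n0 <= N ->
    2 * num_intpart N (fun s => size (undup s) < D) <= npart N.
Proof.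
(* As [N + 1 <= (r + 2) ^ 2], the bound [((N + 1) ^ 2) ^ D] is at most [(r + 2) ^ (4 D)]; the
   threshold on [N] forces [r0 <= r]. *)
have [r0 r0P] := poly_lt_exp2 (2 * (2 * D)); exists (r0.+2 ^ 2) => N N0.
have [r rN Nr] := sqrt_bracket N.
apply: leq_trans (npart_ge_exp2 rN); apply: leq_trans (r0P r _).
  rewrite leq_mul2l /=; apply: leq_trans (num_few_sizes _ _) _.
  rewrite -expnM [leqRHS]expnM; case: (posnP D) => [->|D0];
    first by rewrite !expn0.
  by rewrite leq_exp2r // muln_gt0.
have : r0.+2 < r.+2 by rewrite -(@ltn_exp2r _ _ 2) //; apply: leq_trans Nr;
  rewrite ltnS.
by lia.
Qed.

Lemma npart_negligible (K : nat) :
  exists n0, forall N, n0 <= N ->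
    K * npart N <= \sum_(1 <= m < N.+1) npart (N - m).
Proof.
(* At least half of all partitions have [2 K] or more part sizes. *)
have [n0 n0P] := few_sizes_negligible (2 * K); exists n0 => N /n0P few.
apply: leq_trans (sum_npart_ge (2 * K) N).
have := npartID N (fun s => 2 * K <= size (undup s)).
rewrite (@eq_num_intpart _ (predC _) (fun s => size (undup s) < 2 * K)) =>
  [E|s _]; last by rewrite /= ltnNge.
rewrite -mulnA mulnCA leq_mul2l; apply/orP; right; lia.
Qed.

Local Open Scope ring_scope.

(** * Moments *)

Lemma sum_by_parts (c F : nat -> int) (N : nat) : c 0%N = 0 ->
  \sum_(1 <= m < N.+1) c m * (F m - F m.+1) =
  \sum_(1 <= m < N.+1) (c m - c m.-1) * F m - c N * F N.+1.
Proof.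
move=> c0; elim: N => [|N IH]; first by rewrite !big_nil c0 mul0r subr0.
rewrite !(big_nat_recr N.+1) //= IH; ring.
Qed.

(** As [0.-1 = 0], the value at [m = 0] is 0, the boundary value for the second summation by
    parts. *)
Definition pow_diff (r m : nat) : int := m%:Z ^+ r - m.-1%:Z ^+ r.

Lemma pow_diff_ge0 r m : 0 <= pow_diff r m.
Proof. by rewrite subr_ge0 lerXn2r ?nnegrE // lez_nat leq_pred. Qed.

Lemma pow_diffS r m : pow_diff r.+1 m.+1 = m.+1%:Z * pow_diff r m.+1 + m%:Z ^+
  r.
Proof. by rewrite /pow_diff /= !exprS mulrBr; rewrite intS; ring. Qed.

(** Convexity of the power, by induction on the exponent through [pow_diffS]. *)
Lemma pow_diff_homo r m : pow_diff r m <= pow_diff r m.+1.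
Proof.
case: m => [|m]; first by rewrite {1}/pow_diff subrr pow_diff_ge0.
elim: r => [|r IH]; first by rewrite /pow_diff !expr0.
rewrite !pow_diffS lerD // ?lerXn2r ?nnegrE ?lez_nat //.
by rewrite ler_pM ?pow_diff_ge0 ?lez_nat.
Qed.

Lemma pow_diff_gt0 r m : (0 < r)%N -> (0 < m)%N -> 1 <= pow_diff r m.
Proof.
case: r => // r _; case: m => // m _; elim: m => [|m IH];
  last exact: le_trans IH (pow_diff_homo _ _).
by rewrite /pow_diff /= expr1n expr0n subr0.
Qed.

Lemma mul_pow_diff_le r m : m%:Z * pow_diff r m <= r%:Z * m%:Z ^+ r.
Proof.
case: m => [|m]; first by rewrite mul0r mulr_ge0 ?exprn_ge0.
elim: r => [|r IH]; first by rewrite /pow_diff !expr0 subrr mulr0.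
rewrite pow_diffS exprS mulrCA ler_wpM2l // (intS r) mulrDl mul1r addrC.
by rewrite lerD // lerXn2r ?nnegrE ?lez_nat.
Qed.

Lemma pos_crank_momentE (r N : nat) : (1 < N)%N ->
  pos_crank_moment r N = \sum_(1 <= m < N.+1) m%:Z ^+ r * (beadz m N%:Z - beadz
    m.+1 N%:Z).
Proof.
move=> N1; rewrite /pos_crank_moment; apply: eq_big_nat => m /andP[m0 _];
  congr (_ * _).
have -> : crank_count m%:Z N = (num_intpart N (fun s =>
  part_crank s == m%:Z))%:Z.
  by rewrite /crank_count gtn_eqF.
have := crank_countE m0 (negbT (gtn_eqF N1)).
by rewrite /beadz /= => ->; lia.
Qed.

Lemma pos_rank_momentE (r N : nat) :
  pos_rank_moment r N = \sum_(1 <= m < N.+1) m%:Z ^+ r * (rankz m N%:Z - rankz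
    m.+1 N%:Z).
Proof.
rewrite /pos_rank_moment; apply: eq_big_nat => m /andP[m0 _]; congr (_ * _).
by have := rank_countE m N; rewrite /rank_count /rankz /= => ->; lia.
Qed.

Lemma beadz_gt m N : (N < m)%N -> beadz m N%:Z = 0.
Proof. by move=> Nm; rewrite /beadz /= num_bead_gt. Qed.

Lemma crank_excess_gt N : crank_excess N.+1 N = 0.
Proof.
have := @crank_excess_bounds N.+1 N isT; rewrite beadz_gt // => /andP[e0 e1].
by apply/eqP; rewrite eq_le e0 e1.
Qed.

Lemma beadzS_le m N : (0 < m)%N -> beadz m.+1 N%:Z <= beadz m N%:Z.
Proof. by move=> m0; apply: ler_beadz; rewrite ?m0 /=. Qed.

Lemma pos_crank_moment_by_parts (r N : nat) :
    (0 < r)%N -> (1 < N)%N ->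
    pos_crank_moment r N = \sum_(1 <= m < N.+1) pow_diff r m * beadz m N%:Z.
Proof.
move=> r0 N1; rewrite pos_crank_momentE // (sum_by_parts (c := fun m =>
  m%:Z ^+ r)); last by rewrite expr0n gtn_eqF.
by rewrite beadz_gt // mulr0 subr0.
Qed.

Lemma pow_diff_beadz_by_parts (r N : nat) :
  \sum_(1 <= m < N.+1) pow_diff r m * (beadz m N%:Z - beadz m.+1 N%:Z) =
  \sum_(1 <= m < N.+1) (pow_diff r m - pow_diff r m.-1) * beadz m N%:Z.
Proof.
rewrite (sum_by_parts (c := pow_diff r)); last by rewrite /pow_diff subrr.
by rewrite beadz_gt // mulr0 subr0.
Qed.

(** Two summations by parts, on the tail counts and then, by [crank_excessE], on the excesses; the
    boundary terms at [N + 1] vanish. *)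
Lemma pos_moment_diff (r N : nat) :
    (0 < r)%N -> (1 < N)%N ->
    pos_crank_moment r N - pos_rank_moment r N =
  \sum_(1 <= m < N.+1) (pow_diff r m - pow_diff r m.-1) * crank_excess m N.
Proof.
move=> r0 N1; rewrite pos_crank_momentE // pos_rank_momentE // -sumrB.
rewrite (eq_bigr (fun m => m%:Z ^+ r * ((beadz m N%:Z - rankz m N%:Z) -
    (beadz m.+1 N%:Z - rankz m.+1 N%:Z)))) => [|m _]; last by ring.
rewrite (sum_by_parts (c := fun m => m%:Z ^+ r)
  (fun m => beadz m N%:Z - rankz m N%:Z)); last by rewrite expr0n gtn_eqF.
rewrite beadz_gt // {2}/rankz /= num_rank_gt // subrr mulr0 subr0.
rewrite (eq_big_nat _ _ (F2 := fun m => pow_diff r m *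
    (crank_excess m N - crank_excess m.+1 N))) => [|m /andP[m0 _]]; last first.
  by rewrite -crank_excessE.
rewrite (sum_by_parts (c := pow_diff r) (fun m => crank_excess m N)).
  by rewrite crank_excess_gt mulr0 subr0.
by rewrite /pow_diff subrr.
Qed.

Lemma pow_diff_pred_ge0 r m : 0 <= pow_diff r m - pow_diff r m.-1.
Proof. by case: m => [|m]; rewrite subr_ge0 ?pow_diff_homo. Qed.

(** The term [m = 1] has weight 1 and the others are nonnegative by convexity. *)
Lemma pos_moment_diff_ge (r N : nat) :
    (0 < r)%N -> (1 < N)%N ->
  crank_excess 1 N <= pos_crank_moment r N - pos_rank_moment r N.
Proof.
move=> r0 N1; rewrite pos_moment_diff // big_nat_recl ?(ltnW N1) //=.
have -> : pow_diff r 1 - pow_diff r 0 = 1 by rewrite /pow_diff /= expr1n subrr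
  subr0 expr0n gtn_eqF // subr0.
rewrite mul1r lerDl; apply: sumr_ge0 => m _.
by rewrite mulr_ge0 ?pow_diff_pred_ge0 //;
  case/andP: (@crank_excess_bounds m.+1 N isT).
Qed.

Lemma pos_moment_diff_le (r N : nat) :
    (0 < r)%N -> (1 < N)%N ->
    pos_crank_moment r N - pos_rank_moment r N <=
  \sum_(1 <= m < N.+1) pow_diff r m * (beadz m N%:Z - beadz m.+1 N%:Z).
Proof.
move=> r0 N1; rewrite pos_moment_diff // pow_diff_beadz_by_parts.
rewrite !big_nat; apply: ler_sum => m /andP[m0 _].
by rewrite ler_wpM2l ?pow_diff_pred_ge0 //;
  case/andP: (@crank_excess_bounds m N m0).
Qed.

(* For [m >= 2 K r] the weight [pow_diff r m <= r m ^ (r - 1)] is at most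
   [m ^ r / (2 K)]; the smaller [m] only contribute a multiple of the number of
   partitions. *)
Lemma pos_moment_diff_npart (r N K : nat) :
    (0 < r)%N -> (1 < N)%N ->
  (2 * K)%:Z * (pos_crank_moment r N - pos_rank_moment r N) <=
  pos_crank_moment r N + (2 * K)%:Z * (2 * K * r)%:Z ^+ r * (npart N)%:Z.
Proof.
move=> r0 N1; set B := (2 * K * r)%N.
apply: (le_trans (ler_wpM2l _ (pos_moment_diff_le r0 N1))) => //.
have crank0 m : (0 < m)%N -> 0 <= beadz m N%:Z - beadz m.+1 N%:Z.
  by move=> m0; rewrite subr_ge0 beadzS_le.
(* One weight dominates both ranges: its first summand serves [m >= B], its second [m < B]. *)
apply: (@le_trans _ _ (\sum_(1 <= m < N.+1)
    (m%:Z ^+ r + (2 * K)%:Z * B%:Z ^+ r) * (beadz m N%:Z - beadz m.+1 N%:Z))).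
  rewrite mulr_sumr !big_nat; apply: ler_sum => m /andP[m0 _].
  rewrite mulrA ler_wpM2r ?crank0 //.
  have [Bm|mB] := leqP B m.
    apply: (@le_trans _ _ (m%:Z ^+ r));
      last by rewrite lerDl mulr_ge0 ?exprn_ge0.
    rewrite -(@ler_pM2r _ r%:Z) ?ltz_nat // mulrAC [leRHS]mulrC.
    apply: le_trans (mul_pow_diff_le r m).
    by rewrite ler_wpM2r ?pow_diff_ge0 // -PoszM lez_nat.
  rewrite -[leLHS]add0r lerD ?exprn_ge0 // ler_wpM2l //.
  apply: (@le_trans _ _ (m%:Z ^+ r));
    first by rewrite /pow_diff gerBl exprn_ge0.
  by rewrite lerXn2r ?nnegrE // lez_nat ltnW.
under eq_bigr do rewrite mulrDl.
rewrite big_split /= -pos_crank_momentE // lerD2l -mulr_sumr.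
rewrite ler_wpM2l ?mulr_ge0 ?exprn_ge0 //.
under eq_bigr do rewrite -opprB.
rewrite sumrN (telescope_sumr (fun m =>
  beadz m N%:Z)) // opprB (@beadz_gt N.+1) // subr0.
by rewrite /beadz /= lez_nat num_intpart_le.
Qed.

(** By [beadz_rec], [npart (N - m)] is a sum of two bead counts, each at most [beadz m N]. *)
Lemma npart_pos_crank_moment (r N : nat) :
    (0 < r)%N -> (1 < N)%N ->
    (\sum_(1 <= m < N.+1) npart (N - m))%:Z <= 2 * pos_crank_moment r N.
Proof.
move=> r0 N1; rewrite pos_crank_moment_by_parts // mulr_sumr -natz natr_sum
  !big_nat.
apply: ler_sum => m /andP[m0 mN]; rewrite natz.
have := beadz_rec N%:Z m0; rewrite subzn // => E.
have : beadz m.+1 (N - m)%N%:Z <= beadz m N%:Z by apply: ler_beadz; lia.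
have : beadz m N%:Z <= pow_diff r m * beadz m N%:Z.
  by rewrite ler_peMl ?intext_ge0 // pow_diff_gt0.
by move: E; rewrite /npartz /=; lia.
Qed.

(** The excess is at least the count of crank at least 1 minus that of crank at least 3, hence at
    least the number of partitions of crank 1, such as [N - 3, 2, 1]: one 1 and two larger parts. *)
Lemma crank_excess1_gt0 N : (4 < N)%N -> 0 < crank_excess 1 N.
Proof.
move=> N4; rewrite /crank_excess bead_alt_rec.
have /andP[_ le3] := @bead_alt_bounds N 4 3 (N%:Z - 2%:Z) isT.
have le3' : beadz 3 (N%:Z - 2%:Z) <= beadz 3 N%:Z by apply: ler_beadz; lia.
have c1 := crank_countE (N := N) (isT : (0 < 1)%N) ltac:(lia).
have c2 := crank_countE (N := N) (isT : (0 < 2)%N) ltac:(lia).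
suff c1_gt0 : (0 < num_intpart N (fun s => part_crank s == 1%:Z))%N.
  rewrite subr_gt0; apply: le_lt_trans le3 (le_lt_trans le3' _).
  by rewrite /beadz /= ltz_nat c1 c2; lia.
apply: (@leq_trans #|[set: unit]|); first by rewrite cardsT card_unit.
apply: (@leq_card_num_intpart _ _ (fun=> [:: N - 3; 2; 1]%N)) => [_ _|[] []] //.
rewrite /is_intpart /part_crank /ones /mu /ones /= !inE.
have -> : (N - 3 == 1)%N = false by lia.
by rewrite /=; lia.
Qed.

Lemma pos_crank_moment_gt r N : (0 < r)%N -> (4 < N)%N ->
  pos_rank_moment r N < pos_crank_moment r N.
Proof.
move=> r0 N4; rewrite -subr_gt0; apply: lt_le_trans (crank_excess1_gt0 N4) _.
by apply: pos_moment_diff_ge => //; apply: leq_trans N4.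
Qed.

Lemma pos_moment_diff_negligible r (K : nat) : (0 < r)%N ->
  exists n0, forall N, (n0 <= N)%N ->
    K%:Z * (pos_crank_moment r N - pos_rank_moment r N) <= pos_crank_moment r N.
Proof.
(* [B] is the coefficient of [npart N] in [pos_moment_diff_npart]. Taking [2 * B] below gives
   [B * npart N] at most the crank moment, so [2 K] times the difference is at most twice that
   moment. *)
move=> r0; pose B := (2 * K * (2 * K * r) ^ r)%N.
have [n0 n0P] := npart_negligible (2 * B); exists (maxn n0 2) => N.
rewrite geq_max => /andP[/n0P pN N1].
have := @pos_moment_diff_npart r N K r0 N1.
have := npart_pos_crank_moment r0 N1.
have BE : (2 * K)%:Z * (2 * K * r)%:Z ^+ r = B%:Z by rewrite /B PoszM -(natz (2
  * K * r)%N) -natrX natz.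
rewrite BE -PoszM PoszM; nia.
Qed.

Local Open Scope classical_set_scope.

Theorem corollary1p3 (R : realType) (r : nat) (hr : (1 <= r)%N) :
  (fun N : nat => (pos_crank_moment r N)%:~R : R)
    ~_\oo (fun N : nat => (pos_rank_moment r N)%:~R : R) /\
  exists n_r : nat, forall N : nat, (n_r <= N)%N ->
    pos_rank_moment r N < pos_crank_moment r N.
Proof.
split; last by exists 5%N => N; apply: pos_crank_moment_gt.
apply/eqaddoP => eps eps0.
pose K := Num.bound eps^-1.
have Keps : 1 <= K%:R * eps.
  by rewrite -ler_pdivrMr // div1r ltW // archi_boundP // invr_ge0 ltW.
(* [K + 1] rather than [K]: subtracting one copy of the difference replaces the crank moment by the
   rank moment in the bound. *)
have [n0 n0P] := pos_moment_diff_negligible K.+1 hr.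
exists (maxn n0 5) => // N /=; rewrite geq_max => /andP[/n0P small N5].
have pos := pos_crank_moment_gt hr N5.
set M := pos_crank_moment r N in small pos *.
set M' := pos_rank_moment r N in small pos *.
have KM : K%:R * (M%:~R - M'%:~R : R) <= M'%:~R.
  rewrite -rmorphB -[K%:R]/((K%:Z)%:~R) -intrM ler_int; lia.
rewrite -[(_ - _) N]/(M%:~R - M'%:~R : R).
have d0 : 0 <= M%:~R - M'%:~R :> R by rewrite -rmorphB ler0z; lia.
have M'0 : 0 <= M'%:~R :> R by apply: le_trans KM; rewrite mulr_ge0.
rewrite !ger0_norm //.
apply: le_trans (ler_wpM2l (ltW eps0) KM).
by rewrite mulrA [eps * _]mulrC ler_peMl.
Qed.
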